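(* Let $\ell\ge 1$, let $(\xi_k)_{k=-\infty}^{\infty}$ be an i.i.d. sequence of real random variables, let $f:\mathbb R^\ell\to\mathbb R$ be measurable, and let $X_k=f(\xi_k,\dots,\xi_{k+\ell-1})$, $k\in\mathbb Z$, be the corresponding $\ell$-block factor. Suppose that $X_k$ has finite variance, let $S_n:=\sum_{i=1}^n X_i$ and let $\sigma^2:=\lim_{n\to\infty} n^{-1}\operatorname{Var}(S_n)$. If $\sigma^2=0$, then there exist a measurable function $g:\mathbb R^{\ell-1}\to\mathbb R$ and a constant $\mu\in\mathbb R$ such that the $(\ell-1)$-block factor $Y_k:=g(\xi_{k+1},\dots,\xi_{k+\ell-1})$, $k\in\mathbb Z$, has finite variance and, for every $k\in\mathbb Z$, $$X_k=Y_k-Y_{k-1}+\mu\quad\text{a.s.}$$ The function $g$ is a.s. unique up to an additive constant: if $\tilde g:\mathbb R^{\ell-1}\to\mathbb R$ and a constant $\tilde\mu$ also have these properties, then there is a constant $C$ such that $\tilde g(\xi_1,\dots,\xi_{\ell-1})=g(\xi_1,\dots,\xi_{\ell-1})+C$ a.s.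
   Context: A sequence $(X_k)_{k=-\infty}^\infty$ is an $\ell$-block factor if there is an i.i.d. sequence $(\xi_k)_{k=-\infty}^\infty$ and a measurable function $f:\mathbb R^\ell\to\mathbb R$ such that $X_k=f(\xi_k,\dots,\xi_{k+\ell-1})$ for all $k$. Such a sequence is strictly stationary, and $(X_k)_{k\le 0}$ is independent of $(X_k)_{k\ge \ell}$; when $X_k$ has finite variance ($\mathbb E X_k^2<\infty$), the limit defining $\sigma^2$ exists. When $\ell=1$, $\mathbb R^{\ell-1}=\mathbb R^0$ is a single point and a function $g$ on it is a constant. *)

(* Defs.v *)
From HB Require Import structures.
From mathcomp Require Import all_boot all_order all_algebra.
From mathcomp Require Import all_classical all_reals all_analysis.
Set Implicit Arguments.
Unset Strict Implicit.
Unset Printing Implicit Defensive.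
Import Order.TTheory GRing.Theory Num.Theory.
Import numFieldNormedType.Exports.
Local Open Scope classical_set_scope.
Local Open Scope ring_scope.

Definition mutually_independent d (T : measurableType d) (R : realType)
    (P : probability T R) (I : eqType) (X : I -> {RV P >-> R}) : Prop :=
  forall (s : seq I) (A : I -> set R), uniq s ->
    (forall i, measurable (A i)) ->
    P (\bigcap_(i in [set` s]) (X i @^-1` A i)) =
    (\prod_(i <- s) P (X i @^-1` A i))%E.

Definition identically_distributed d (T : measurableType d) (R : realType)
    (P : probability T R) (I : Type) (X : I -> {RV P >-> R}) : Prop :=
  forall (i j : I) (A : set R), measurable A ->
    distribution P (X i) A = distribution P (X j) A.

Definition iid d (T : measurableType d) (R : realType)
    (P : probability T R) (I : eqType) (X : I -> {RV P >-> R}) : Prop :=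
  mutually_independent X /\ identically_distributed X.

(* [(xi_k, ..., xi_(k+n-1))]; when [n = 0] this is the unique empty tuple. *)
Definition window d (T : measurableType d) (R : realType)
    (P : probability T R) (xi : int -> {RV P >-> R}) (n : nat) (k : int)
    (w : T) : n.-tuple R :=
  [tuple xi (k + i%:Z) w | i < n].

Definition block_factor d (T : measurableType d) (R : realType)
    (P : probability T R) (xi : int -> {RV P >-> R}) (n : nat)
    (f : n.-tuple R -> R) (k : int) (w : T) : R :=
  f (window xi n k w).

Definition partial_sum (T : Type) (R : realType) (X : int -> T -> R)
    (n : nat) (w : T) : R :=
  \sum_(1 <= i < n.+1) X i%:Z w.

(* [lim] returns a default value on divergent sequences; for block factors with
   finite variance the sequence converges. *)
Definition asymptotic_variance d (T : measurableType d) (R : realType)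
    (P : probability T R) (X : int -> T -> R) : \bar R :=
  limn (fun n : nat => ((n%:R^-1)%:E * 'V_P[partial_sum X n])%E).

(* The process [Y_k = g (xi_(k+1), ..., xi_(k+l-1))] is [block_factor xi g]
   shifted by one. *)
Definition coboundary_decomposition d (T : measurableType d) (R : realType)
    (P : probability T R) (xi : int -> {RV P >-> R}) (X : int -> T -> R)
    (n : nat) (g : n.-tuple R -> R) (mu : R) : Prop :=
  let Y k := block_factor xi g (k + 1) in
  [/\ measurable_fun [set: n.-tuple R] g,
      forall k : int, Y k \in Lfun P 2%:E
    & forall k : int, {ae P, forall w, X k w = Y k w - Y (k - 1) w + mu}].

(* Main.v *)
(* With m = l - 1 and X centered, put Y_k := - E[X_k + ... + X_(k+m-1) | xi_j, j < k + m],
   a function of (xi_k, ..., xi_(k+m-1)).  Then D_k := X_k - Y_(k+1) + Y_k is a stationary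
   sequence of square-integrable martingale increments, so
   S_n = D_1 + ... + D_n + Y_(n+1) - Y_1 has Var(S_n) = n E[D_1^2] + O(sqrt n), the boundary
   term being bounded in L^2.  Hence sigma^2 = E[D_1^2], and sigma^2 = 0 forces D_k = 0 a.s.
   For uniqueness, the difference h of two solutions satisfies H_(k+1) = H_k + c a.s. for
   H_k = h(xi_k, ..., xi_(k+m-1)).  Taking means gives c = 0, so H_1 = H_(1+m) a.s., and these
   two variables are independent, so they are constant. *)
Require Import Defs.
From HB Require Import structures.
From mathcomp Require Import all_boot all_order all_algebra.
From mathcomp Require Import all_classical all_reals all_analysis.
From mathcomp Require Import measurable_realfun ring lra.
Import Order.TTheory GRing.Theory Num.Theory.
Import numFieldNormedType.Exports.
Local Open Scope classical_set_scope.
Local Open Scope ring_scope.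
Set Implicit Arguments.
Unset Strict Implicit.
Unset Printing Implicit Defensive.

(** * Laws on tuples *)

Definition tuple_box (T : Type) (n : nat) (A : 'I_n -> set T) : set (n.-tuple T) :=
  [set t | forall i, A i (tnth t i)].

Lemma measurable_tuple_box d (T : measurableType d) (n : nat) (A : 'I_n -> set T) :
  (forall i, measurable (A i)) -> measurable (tuple_box A).
Proof.
move=> mA.
have -> : tuple_box A = \big[setI/setT]_(i < n) ((@tnth n T ^~ i) @^-1` A i).
  rewrite -bigcap_seq; apply/seteqP; split => [t At i _|t At i]; first exact: At.
  by apply: At => /=; rewrite mem_index_enum.
apply: bigsetI_measurable => i _.
by rewrite -[X in measurable X]setTI; exact: measurable_tnth.
Qed.

(** Boxes are stable under intersection, contain the whole space and generate the sigma-algebra on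
    tuples, so the uniqueness theorem for measures applies. *)
Lemma tuple_measure_unique d (T : measurableType d) (R : realType) (n : nat)
    (m1 m2 : {measure set (n.-tuple T) -> \bar R}) :
  (forall A : 'I_n -> set T, (forall i, measurable (A i)) ->
    m1 (tuple_box A) = m2 (tuple_box A)) ->
  (m1 setT < +oo)%E -> forall B, measurable B -> m1 B = m2 B.
Proof.
move=> m12 m1oo B mB.
have boxT : tuple_box (fun _ : 'I_n => [set: T]) = setT.
  by apply/seteqP; split.
apply: (measure_unique
  [set C | exists2 A : 'I_n -> set T, (forall i, measurable (A i)) & C = tuple_box A]
  (fun=> setT)) => //.
- apply/seteqP; split.
    apply: smallest_sub; first exact: smallest_sigma_algebra.
    apply: subset_trans; last exact: sub_gen_smallest.
    rewrite -bigcup_seq => C [i _ [A mA <-]]; rewrite setTI.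
    (* A generator constrains the single coordinate [i]; as a box it is full in every other
       coordinate. *)
    exists (fun j => if j == i then A else setT).
      by move=> j; case: ifP.
    apply/seteqP; split => t /=.
      by move=> At j; case: eqP => [->|].
    by move=> /(_ i); rewrite eqxx.
  apply: smallest_sub; first exact: sigma_algebra_measurable.
  by move=> _ [A mA ->]; exact: measurable_tuple_box.
- move=> _ _ [A mA ->] [A' mA' ->]; exists (fun i => A i `&` A' i).
    by move=> i; exact: measurableI.
  apply/seteqP; split => [t [At A't] i|t At]; first by split.
  by split => i; have [] := At i.
- by move=> _; exists (fun=> setT).
- by rewrite bigcup_const//; exists 0%N.
- by move=> _ [A mA ->]; exact: m12.
Qed.

Section independence.
Context d (T : measurableType d) (R : realType) (P : probability T R).

(** For fixed [E] both sides are finite measures in [B]: the law of [U] under [P] restricted to [E],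
    and the law of [U] scaled by [P E]. Agreement on boxes therefore suffices. *)
Lemma independent_of_boxes d' (T' : measurableType d') (n : nat)
    (U : {mfun T >-> n.-tuple T'}) (E : set T) : measurable E ->
  (forall A : 'I_n -> set T', (forall i, measurable (A i)) ->
    P ((U @^-1` tuple_box A) `&` E) = (P (U @^-1` tuple_box A) * P E)%E) ->
  forall B, measurable B -> P ((U @^-1` B) `&` E) = (P (U @^-1` B) * P E)%E.
Proof.
move=> mE boxE B mB.
have PE0 : 0 <= fine (P E) by rewrite fine_ge0.
have PEE : P E = (fine (P E))%:E by rewrite fineK// fin_num_measure.
pose m1 : {measure set (n.-tuple T') -> \bar R} :=
  pushforward (mrestr P mE) U.
pose m2 : {measure set (n.-tuple T') -> \bar R} :=
  mscale (NngNum PE0) (distribution P U).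
have := @tuple_measure_unique _ _ _ n (m1 (measurable_funPT U)) m2 _ _ B mB.
rewrite /m1 /m2 /= /mscale/= /pushforward /mrestr/= /distribution /pushforward => ->.
- by rewrite muleC -PEE.
- by move=> A mA; rewrite boxE// muleC -PEE.
- by rewrite preimage_setT setTI (le_lt_trans (probability_le1 _ _)) ?ltry.
Qed.
End independence.

(** * Windows of an i.i.d. sequence *)

(* Positions beyond the end of [t] are filled with the junk value [0]. *)
Definition subtuple (R : pzRingType) (N n i : nat) (t : N.-tuple R) : n.-tuple R :=
  [tuple t`_(i + j) | j < n].

Lemma measurable_subtuple (R : realType) (N n i : nat) :
  measurable_fun setT (@subtuple R N n i).
Proof.
apply/measurable_fun_tnthP => j.
rewrite (_ : _ \o _ = fun t : N.-tuple R => t`_(i + j)); last first.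
  by apply/funext => t /=; rewrite tnth_mktuple.
have [ijN|Nij] := ltnP (i + j) N.
  rewrite (_ : (fun _ => _) = @tnth N R ^~ (Ordinal ijN)).
    exact: measurable_tnth.
  by apply/funext => t; rewrite (tnth_nth 0).
rewrite (_ : (fun _ => _) = cst 0); first exact: measurable_cst.
by apply/funext => t; rewrite nth_default// size_tuple.
Qed.

Lemma measurable_cat_tuple d (T : measurableType d) (n m : nat) :
  measurable_fun setT
    (fun p : n.-tuple T * m.-tuple T => cat_tuple p.1 p.2).
Proof.
apply/measurable_fun_tnthP => i.
case: (splitP i) => j ij.
  rewrite (_ : _ \o _ = (fun t => tnth t j) \o fst).
    by apply: measurableT_comp; [exact: measurable_tnth|exact: measurable_fst].
  apply/funext => -[a b] /=.
  rewrite (_ : i = lshift m j) ?tnth_lshift//; exact/val_inj.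
rewrite (_ : _ \o _ = (fun t => tnth t j) \o snd).
  by apply: measurableT_comp; [exact: measurable_tnth|exact: measurable_snd].
apply/funext => -[a b] /=.
rewrite (_ : i = rshift n j) ?tnth_rshift//; exact/val_inj.
Qed.

Section windows.
Context d (T : measurableType d) (R : realType) (P : probability T R).
Variable xi : int -> {RV P >-> R}.

Lemma measurable_window (n : nat) (k : int) : measurable_fun setT (window xi n k).
Proof.
apply/measurable_fun_tnthP => i.
rewrite (_ : _ \o _ = xi (k + i%:Z)); first exact: measurable_funPT.
by apply/funext => w /=; rewrite tnth_mktuple.
Qed.

HB.instance Definition _ (n : nat) (k : int) :=
  isMeasurableFun.Build _ _ _ _ (window xi n k) (@measurable_window n k).

Lemma window_sub (n N i : nat) (k : int) (w : T) : (i + n <= N)%N ->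
  window xi n (k + i%:Z) w = subtuple n i (window xi N k w).
Proof.
move=> inN; apply/eq_from_tnth => j; rewrite !tnth_mktuple.
have ijN : (i + j < N)%N by rewrite (leq_trans _ inN)// ltn_add2l.
rewrite -[X in _`_X]/(nat_of_ord (Ordinal ijN)) -tnth_nth tnth_mktuple/=.
by rewrite PoszD addrA.
Qed.

Lemma window_cat (n m : nat) (k : int) (w : T) :
  cat_tuple (window xi n k w) (window xi m (k + n%:Z) w) = window xi (n + m) k w.
Proof.
apply/eq_from_tnth => i; case: (splitP i) => j ij.
  by rewrite (_ : i = lshift m j) ?tnth_lshift ?tnth_mktuple//; exact/val_inj.
rewrite (_ : i = rshift n j) ?tnth_rshift ?tnth_mktuple/=; last exact/val_inj.
by rewrite PoszD addrA.
Qed.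

Hypothesis xi_iid : iid xi.

Lemma window_box (n : nat) (k : int) (A : 'I_n -> set R) :
  (forall i, measurable (A i)) ->
  P (window xi n k @^-1` tuple_box A) =
  (\prod_(i < n) distribution P (xi 0) (A i))%E.
Proof.
move=> mA; have [indep ident] := xi_iid.
pose s := [seq k + i%:Z | i : 'I_n <- enum 'I_n].
(* Independence asks for a set at every integer. Only the positions in [s] enter the product, and
   [BA] gives [A i] back there; what [B] does to the left of [k] is irrelevant. *)
pose B (z : int) : set R :=
  if insub `|z - k|%N is Some i then A i else setT.
have BA (i : 'I_n) : B (k + i%:Z) = A i.
  by rewrite /B addrC addKr absz_nat valK.
have us : uniq s.
  rewrite map_inj_uniq ?enum_uniq// => i j /addrI[ij]; exact/val_inj.
have mB z : measurable (B z) by rewrite /B; case: insub.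
have := indep s B us mB.
rewrite big_map big_enum/= => prodE.
transitivity (P (\bigcap_(i in [set` s]) xi i @^-1` B i)).
  congr (P _); apply/seteqP; split => w.
    move=> Aw _ /= /mapP[i _ ->]; rewrite BA.
    by have := Aw i; rewrite tnth_mktuple.
  move=> Bw i; rewrite tnth_mktuple -BA; apply: (Bw (k + i%:Z)) => /=.
  by apply/mapP; exists i; rewrite ?mem_enum.
rewrite prodE; apply: eq_bigr => i _; rewrite BA.
exact: ident.
Qed.

Definition window_law (n : nat) : probability (n.-tuple R) R :=
  distribution P (window xi n 0).

(** Stationarity: the probability that [window_box] gives to a box does not involve [k]. *)
Lemma window_lawE (n : nat) (k : int) (B : set (n.-tuple R)) :
  measurable B -> window_law n B = P (window xi n k @^-1` B).
Proof.
move=> mB.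
apply: (@tuple_measure_unique _ _ _ n
  (distribution P (window xi n 0)) (distribution P (window xi n k))) => //.
  by move=> A mA; exact: etrans (window_box 0 mA) (esym (window_box k mA)).
by apply: (le_lt_trans (probability_le1 (distribution P (window xi n 0)) measurableT)); exact: ltry.
Qed.

(** Two passes of [independent_of_boxes], one for each window, reduce the claim to boxes. Boxes on
    two adjacent windows form one box on the joined window, and its probability is a product. *)
Lemma window_independent (n m : nat) (k : int) (A : set (n.-tuple R))
    (B : set (m.-tuple R)) : measurable A -> measurable B ->
  P ((window xi n k @^-1` A) `&` (window xi m (k + n%:Z) @^-1` B)) =
  (window_law n A * window_law m B)%E.
Proof.
move=> mA mB; rewrite (window_lawE k mA) (window_lawE (k + n%:Z) mB).
have mw N j (C : set (N.-tuple R)) : measurable C -> measurable (window xi N j @^-1` C).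
  by move=> mC; rewrite -[X in measurable X]setTI; exact: measurable_window.
apply: (@independent_of_boxes _ _ _ P _ _ n (window xi n k)) => //; first exact: mw.
move=> A' mA'; rewrite setIC muleC.
apply: (@independent_of_boxes _ _ _ P _ _ m (window xi m (k + n%:Z))) => //.
  by apply: mw; exact: measurable_tuple_box.
move=> B' mB'; rewrite setIC muleC !window_box//.
pose C (i : 'I_(n + m)) := match fintype.split i with inl j => A' j | inr j => B' j end.
have Cl j : C (lshift m j) = A' j.
  by rewrite /C; case: fintype.split_ordP => [j0 /lshift_inj->//|j0 /eqP]; rewrite eq_lrshift.
have Cr j : C (rshift n j) = B' j.
  by rewrite /C; case: fintype.split_ordP => [j0 /eqP|j0 /rshift_inj->//]; rewrite eq_rlshift.
have mC i : measurable (C i) by rewrite /C; case: fintype.split.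
have -> : window xi n k @^-1` tuple_box A' `&`
    window xi m (k + n%:Z) @^-1` tuple_box B' = window xi (n + m) k @^-1` tuple_box C.
  apply/seteqP; split => w.
    move=> [Aw Bw] i; rewrite -window_cat.
    case: (split_ordP i) => j ->.
      by rewrite Cl tnth_lshift.
    by rewrite Cr tnth_rshift.
  rewrite /tuple_box/= -window_cat => Cw; split => j.
    by have := Cw (lshift m j); rewrite Cl tnth_lshift.
  by have := Cw (rshift n j); rewrite Cr tnth_rshift.
rewrite window_box// big_split_ord/=.
by congr (_ * _)%E; apply: eq_bigr => i _; rewrite ?Cl ?Cr.
Qed.

End windows.
Arguments window_law {d T R P} xi n.
Arguments measurable_window {d T R P} xi n k.

(** * Transfer of integrals and L^2 *)

Section law_transfer.
Context d d' (T : measurableType d) (T' : measurableType d') (R : realType).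
Variables (P : {measure set T -> \bar R}) (Q : {measure set T' -> \bar R}).
Variable phi : T -> T'.
Hypothesis mphi : measurable_fun [set: _] phi.
Hypothesis lawE : forall B, measurable B -> Q B = P (phi @^-1` B).
Local Open Scope ereal_scope.

(** [Q] is tied to [phi] only through [lawE], so that it can be a window law as well as the product
    of two window laws. *)
Lemma law_ge0_integral (f : T' -> \bar R) :
  measurable_fun [set: _] f -> (forall y, 0 <= f y) ->
  \int[Q]_y f y = \int[P]_x f (phi x).
Proof.
move=> mf f0.
pose P' : {measure set T' -> \bar R} := pushforward P phi.
rewrite (eq_measure_integral (P' mphi)) => [|B mB _]; last exact: lawE.
by rewrite /P' ge0_integral_pushforward.
Qed.

Lemma law_integrable (f : T' -> \bar R) : measurable_fun [set: _] f ->
  Q.-integrable setT f <-> P.-integrable setT (f \o phi).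
Proof.
move=> mf; have mabs : measurable_fun [set: _] (abse \o f) by exact: measurableT_comp.
have absE := law_ge0_integral mabs (fun=> abse_ge0 _).
split=> /integrableP[_ foo]; apply/integrableP; split => //.
- exact: measurableT_comp.
- by rewrite /= in absE *; rewrite -absE.
- by rewrite /= in absE *; rewrite absE.
Qed.

Lemma law_integral (f : T' -> \bar R) : measurable_fun [set: _] f ->
  P.-integrable setT (f \o phi) -> \int[Q]_y f y = \int[P]_x f (phi x).
Proof.
move=> mf intf.
pose P' : {measure set T' -> \bar R} := pushforward P phi.
rewrite (eq_measure_integral (P' mphi)) => [|B mB _]; last exact: lawE.
by rewrite /P' integral_pushforward.
Qed.

End law_transfer.

Section Lfun2.
Context d (T : measurableType d) (R : realType) (P : probability T R).
Implicit Types f g : T -> R.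

Lemma Lfun2P f : f \in Lfun P 2%:E <->
  measurable_fun [set: _] f /\ P.-integrable setT (EFin \o (fun x => f x ^+ 2)).
Proof.
split=> [fL2|[mf f2]].
  split; last exact: Lfun2_integrable_sqr.
  by move: fL2; rewrite inE => /andP[]; rewrite inE.
rewrite inE; apply/andP; split; rewrite inE//= /finite_norm unlock.
apply: poweR_lty.
have /integrableP[_] := f2; apply: le_lt_trans.
rewrite le_eqVlt; apply/orP; left; apply/eqP/eq_integral => x _ /=.
by rewrite powR_mulrn// normrX.
Qed.

Lemma Lfun2_measurable f : f \in Lfun P 2%:E -> measurable_fun [set: _] f.
Proof. by move/Lfun2P => -[]. Qed.

Lemma Lfun2_integrable f : f \in Lfun P 2%:E -> P.-integrable setT (EFin \o f).
Proof.
by move=> f2; apply/Lfun1_integrable; apply: Lfun_subset12; rewrite ?fin_num_measure.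
Qed.

Lemma Lfun2_integrableM f g : f \in Lfun P 2%:E -> g \in Lfun P 2%:E ->
  P.-integrable setT (EFin \o (fun x => f x * g x)).
Proof. by move=> f2 g2; apply/Lfun1_integrable; exact: Lfun2_mul_Lfun1. Qed.

Lemma Lfun2D f g : f \in Lfun P 2%:E -> g \in Lfun P 2%:E ->
  (fun x => f x + g x) \in Lfun P 2%:E.
Proof. by move=> f2 g2; rewrite (@rpredD _ (Lfun P 2%:E) f g) ?lee1n. Qed.

Lemma Lfun2B f g : f \in Lfun P 2%:E -> g \in Lfun P 2%:E ->
  (fun x => f x - g x) \in Lfun P 2%:E.
Proof. by move=> f2 g2; rewrite (@rpredB _ (Lfun P 2%:E) f g) ?lee1n. Qed.

Lemma Lfun2N f : f \in Lfun P 2%:E -> (fun x => - f x) \in Lfun P 2%:E.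
Proof. by move=> f2; rewrite (@rpredN _ (Lfun P 2%:E) f) ?lee1n. Qed.

Lemma Lfun2_sum (I : Type) (s : seq I) (f : I -> T -> R) :
  (forall i, f i \in Lfun P 2%:E) ->
  (fun x => \sum_(i <- s) f i x) \in Lfun P 2%:E.
Proof.
move=> f2; elim: s => [|i s IH].
  under eq_fun do rewrite big_nil.
  exact: Lfun_cst.
under eq_fun do rewrite big_cons.
exact: Lfun2D.
Qed.

Lemma probability_Rintegral_cst (c : R) : \int[P]_x c = c.
Proof.
by rewrite Rintegral_cst// [X in fine X]probability_setT mulr1.
Qed.

(** This is the nonnegativity of the variance. *)
Lemma sqr_Rintegral_le f : f \in Lfun P 2%:E ->
  (\int[P]_x f x) ^+ 2 <= \int[P]_x (f x ^+ 2).
Proof.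
move=> f2; have := variance_ge0 P f; rewrite varianceE// unlock.
rewrite -[X in (X ^+ 2)%E]fineK ?integrable_fin_num//; last exact: Lfun2_integrable.
rewrite -[X in (X - _)%E]fineK; last first.
  by apply: integrable_fin_num => //; exact: Lfun2_integrable_sqr.
by rewrite -EFin_expe -EFinB lee_fin subr_ge0.
Qed.

Lemma Rintegral_sqr_eq0 f : f \in Lfun P 2%:E ->
  \int[P]_x (f x ^+ 2) = 0 -> {ae P, forall x, f x = 0}.
Proof.
move=> f2 f20; have if2 := Lfun2_integrable_sqr f2.
have : (\int[P]_(x in setT) `|(f x ^+ 2)%:E| = 0)%E.
  under eq_integral do rewrite /= ger0_norm ?sqr_ge0//.
  by rewrite -[LHS]fineK ?integrable_fin_num// [fine _]f20.
move/(ae_eq_integral_abs P measurableT (measurable_int P if2)).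
by apply: filterS => x /= /(_ I) [/eqP]; rewrite sqrf_eq0 => /eqP.
Qed.

End Lfun2.

(** * Conditional means given a window *)

Section block_factors.
Context d (T : measurableType d) (R : realType) (P : probability T R).
Variable xi : int -> {RV P >-> R}.
Hypothesis xi_iid : iid xi.

(** By independence the two measures agree on measurable rectangles, which determine the product
    measure. *)
Lemma window_pair_law (n m : nat) (k : int) (B : set (n.-tuple R * m.-tuple R)) :
  measurable B -> (window_law xi n \x window_law xi m)%E B =
  P ((fun w => (window xi n k w, window xi m (k + n%:Z) w)) @^-1` B).
Proof.
pose pr w := (window xi n k w, window xi m (k + n%:Z) w).
have mpr : measurable_fun [set: T] pr.
  by apply: measurable_fun_pair; exact: measurable_window.
pose P' : {measure set _ -> \bar R} := pushforward P pr.
apply: (product_measure_unique (m' := P' mpr)) => A C mA mC.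
by rewrite -(window_independent xi_iid k mA mC).
Qed.

Lemma window_Lfun2 (n : nat) (k k' : int) (u : n.-tuple R -> R) :
  measurable_fun [set: _] u -> (fun w => u (window xi n k w)) \in Lfun P 2%:E ->
  (fun w => u (window xi n k' w)) \in Lfun P 2%:E.
Proof.
move=> mu /Lfun2P[_ u2]; apply/Lfun2P; split.
  by apply: measurableT_comp mu _; exact: measurable_window.
have mu2 : measurable_fun [set: n.-tuple R] (EFin \o (fun x => u x ^+ 2)).
  by apply/measurable_EFinP; exact: measurable_funX.
have h := law_integrable (measurable_window xi n _) (@window_lawE _ _ _ _ _ xi_iid n _) mu2.
exact/(h k')/(h k).
Qed.

Lemma window_Rintegral (n : nat) (k k' : int) (u : n.-tuple R -> R) :
  measurable_fun [set: _] u -> P.-integrable setT (fun w => (u (window xi n k w))%:E) ->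
  \int[P]_w u (window xi n k w) = \int[P]_w u (window xi n k' w).
Proof.
move=> mu uk.
have mu1 : measurable_fun [set: n.-tuple R] (EFin \o u) by exact/measurable_EFinP.
have h j := law_integrable (measurable_window xi n j)
  (window_lawE xi_iid j) mu1.
have i j := law_integral (measurable_window xi n j)
  (window_lawE xi_iid j) mu1.
rewrite /Rintegral; congr fine.
by rewrite -[LHS]i// -[RHS]i//; exact/h/(h k).
Qed.

(** For adjacent windows [V] and [W] this is a version of E[F (V, W) | V]: by independence it is
    enough to integrate out the second argument. *)
Definition cond_mean (n m : nat) (F : n.-tuple R * m.-tuple R -> R) (v : n.-tuple R) : R :=
  \int[window_law xi m]_w F (v, w).

Section cond_mean.
Variables (n m : nat) (k : int) (F : n.-tuple R * m.-tuple R -> R).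
Hypothesis mF : measurable_fun [set: _] F.
Let V := window xi n k.
Let W := window xi m (k + n%:Z).
Hypothesis iF : P.-integrable setT (fun w => (F (V w, W w))%:E).

Let mVW : measurable_fun [set: T] (fun w => (V w, W w)).
Proof. by apply: measurable_fun_pair; exact: measurable_window. Qed.

Let product_integrable (H : n.-tuple R * m.-tuple R -> R) : measurable_fun [set: _] H ->
  P.-integrable setT (fun w => (H (V w, W w))%:E) ->
  (window_law xi n \x window_law xi m)%E.-integrable setT (EFin \o H).
Proof.
move=> mH iH.
apply: (law_integrable mVW (@window_pair_law n m k) _).2 => //.
exact/measurable_EFinP.
Qed.

Lemma measurable_cond_mean : measurable_fun [set: _] (cond_mean F).
Proof.
by have := measurable_fubini_F (product_integrable mF iF); exact: measurableT_comp.
Qed.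

(** The defining property of conditional expectation, tested against [z (V w)]. It is Fubini's
    theorem for the product law of the two windows. *)
Lemma cond_meanP (z : n.-tuple R -> R) : measurable_fun [set: _] z ->
  P.-integrable setT (fun w => (z (V w) * F (V w, W w))%:E) ->
  \int[P]_w (z (V w) * cond_mean F (V w)) = \int[P]_w (z (V w) * F (V w, W w)).
Proof.
move=> mz izF.
pose H (p : n.-tuple R * m.-tuple R) := z p.1 * F p.
have mH : measurable_fun [set: _] H.
  apply: measurable_funM => //; apply: measurableT_comp => //; exact: measurable_fst.
have mzG : measurable_fun [set: _] (fun v => z v * cond_mean F v).
  by apply: measurable_funM => //; exact: measurable_cond_mean.
have iF' := product_integrable mF iF.
have iH := product_integrable mH izF.
(* The section of [F] at [v] is integrable only for almost every [v]. For the others [cond_mean] may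
   be a default value, so [z v] is pulled out of the integral almost everywhere only. *)
have HG : ae_eq (window_law xi n) setT
    (fubini_F (window_law xi m) (EFin \o H))
    (fun v => (z v * cond_mean F v)%:E).
  have := ae_integrable1 iF'; apply: filterS => v /= Fv _.
  rewrite /fubini_F /H /= /cond_mean /Rintegral EFinM fineK; last first.
    exact: integrable_fin_num.
  by rewrite -integralZl.
have iG : (window_law xi n).-integrable setT (fun v => (z v * cond_mean F v)%:E).
  have /integrableP[mfub fub] := integrable_fubini_F iH.
  have mzG'' : measurable_fun [set: _] (fun v => (z v * cond_mean F v)%:E).
    exact/measurable_EFinP.
  apply/integrableP; split => //; apply: le_lt_trans fub.
  rewrite le_eqVlt; apply/orP; left; apply/eqP; apply: ge0_ae_eq_integral => //.
  - exact: measurableT_comp.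
  - exact: measurableT_comp.
  - by apply: filterS HG => v /= HG /HG ->.
have mzG' : measurable_fun [set: _] (EFin \o (fun v => z v * cond_mean F v)).
  exact/measurable_EFinP.
rewrite /Rintegral; congr fine.
rewrite -(law_integral (measurable_window xi n k) (window_lawE xi_iid k) mzG'); last first.
  by apply/(law_integrable (measurable_window xi n k) (window_lawE xi_iid k) mzG').
have mH' : measurable_fun [set: _] (EFin \o H) by exact/measurable_EFinP.
rewrite -(law_integral mVW (@window_pair_law n m k) mH' izF).
rewrite -integral12_prod_meas1//.
apply: ae_eq_integral => //; last exact: ae_eq_sym.
exact: (measurable_fubini_F iH).
Qed.

(* Jensen's inequality in the second variable, then Tonelli. *)
Lemma cond_mean_Lfun2 : (fun w => F (V w, W w)) \in Lfun P 2%:E ->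
  (fun w => cond_mean F (V w)) \in Lfun P 2%:E.
Proof.
move=> F2; have mG := measurable_cond_mean.
have mF2 : measurable_fun [set: _] (fun p => F p ^+ 2) by exact: measurable_funX.
have iF2 := product_integrable mF2 (Lfun2_integrable_sqr F2).
have mG2 : measurable_fun [set: _] (EFin \o (fun v => cond_mean F v ^+ 2)).
  by apply/measurable_EFinP; exact: measurable_funX.
apply/Lfun2P; split; first exact: measurableT_comp mG (measurable_window xi n k).
apply/(law_integrable (measurable_window xi n k) (window_lawE xi_iid k) mG2).
have /integrableP[mfub fub] := integrable_fubini_F iF2.
apply/integrableP; split => //; apply: le_lt_trans fub.
apply: ae_ge0_le_integral => //.
- exact: measurableT_comp.
- exact: measurableT_comp.
apply: filterS (ae_integrable1 iF2) => v /= Fv2 _.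
have Fv : (fun w => F (v, w)) \in Lfun (window_law xi m) 2%:E.
  by apply/Lfun2P; split => //; exact: measurableT_comp.
rewrite ger0_norm ?sqr_ge0// gee0_abs; last first.
  by apply: integral_ge0 => w _; rewrite lee_fin sqr_ge0.
rewrite -[leRHS]fineK; last exact: integrable_fin_num.
by rewrite lee_fin; exact: sqr_Rintegral_le.
Qed.

End cond_mean.

(** Conditioning on the first window replaces [u] by its mean, which is zero. *)
Lemma window_Rintegral_mul0 (n m : nat) (k : int) (z : n.-tuple R -> R)
    (u : m.-tuple R -> R) :
  measurable_fun [set: _] z -> measurable_fun [set: _] u ->
  (fun w => z (window xi n k w)) \in Lfun P 2%:E ->
  (fun w => u (window xi m (k + n%:Z) w)) \in Lfun P 2%:E ->
  \int[P]_w u (window xi m (k + n%:Z) w) = 0 ->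
  \int[P]_w (z (window xi n k w) * u (window xi m (k + n%:Z) w)) = 0.
Proof.
move=> mz mu z2 u2 u0.
pose F (p : n.-tuple R * m.-tuple R) := u p.2.
have mF : measurable_fun [set: _] F.
  by apply: measurableT_comp => //; exact: measurable_snd.
rewrite -(@cond_meanP n m k F mF (Lfun2_integrable u2) z mz (Lfun2_integrableM z2 u2)).
have F0 v : cond_mean F v = 0.
  rewrite -{}u0 /cond_mean /Rintegral /F /=; congr fine.
  rewrite (law_integral (measurable_window xi m (k + n%:Z)) (window_lawE xi_iid _) (f := EFin \o u))//.
    exact/measurable_EFinP.
  exact: Lfun2_integrable.
under eq_Rintegral do rewrite F0 mulr0.
exact: probability_Rintegral_cst.
Qed.

(** * Rigidity of block factors with a constant increment *)

Lemma ae_eq_Rintegral (f g : T -> R) :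
  measurable_fun [set: _] f -> measurable_fun [set: _] g ->
  {ae P, forall w, f w = g w} -> \int[P]_w f w = \int[P]_w g w.
Proof.
move=> mf mg fg; rewrite /Rintegral; congr fine; apply: ae_eq_integral => //.
- exact/measurable_EFinP.
- exact/measurable_EFinP.
- by apply: filterS fg => w /= ->.
Qed.

(** The uniqueness half of the theorem, where [h] is the difference of two solutions and [c] the
    difference of their constants. *)
Lemma block_factor_cocycle_constant (m : nat) (h : m.-tuple R -> R) (c : R) :
  measurable_fun [set: _] h -> (fun w => h (window xi m 1 w)) \in Lfun P 2%:E ->
  (forall k, {ae P, forall w,
    h (window xi m (k + 1) w) = h (window xi m k w) + c}) ->
  exists C, {ae P, forall w, h (window xi m 1 w) = C}.
Proof.
move=> mh h1 hS.
have h2 k := window_Lfun2 k mh h1.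
have mhw k := Lfun2_measurable (h2 k).
pose C := \int[P]_w h (window xi m 1 w).
have hC k : \int[P]_w h (window xi m k w) = C.
  by apply: window_Rintegral => //; exact: Lfun2_integrable.
have c0 : c = 0.
  have := ae_eq_Rintegral (mhw _) (measurable_funD (mhw 0) (measurable_cst c)) (hS 0).
  rewrite RintegralD//; [|exact: Lfun2_integrable|exact: finite_measure_integrable_cst].
  by rewrite probability_Rintegral_cst !hC -[LHS]addr0 => /addrI.
have hn (j : nat) : {ae P, forall w, h (window xi m (1 + j%:Z) w) = h (window xi m 1 w)}.
  elim: j => [|j IH]; first by apply: aeW => w; rewrite addr0.
  apply: filterS2 IH (hS (1 + j%:Z)) => w hj.
  by rewrite hj c0 addr0 -addrA -PoszD addn1.
exists C.
pose u t := h t - C.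
have mu : measurable_fun [set: _] u.
  by apply: measurable_funB => //; exact: measurable_cst.
have u2 k : (fun w => u (window xi m k w)) \in Lfun P 2%:E.
  by apply: Lfun2B => //; exact: Lfun_cst.
have u0 k : \int[P]_w u (window xi m k w) = 0.
  rewrite RintegralB//; [|exact: Lfun2_integrable|exact: finite_measure_integrable_cst].
  by rewrite probability_Rintegral_cst hC subrr.
(* The windows at [1] and [1 + m] are adjacent, hence independent. Since [u] takes a.s. equal values
   on them, this vanishing product moment is also the second moment of [u]. *)
have uu0 := window_Rintegral_mul0 mu mu (u2 1) (u2 (1 + m%:Z)) (u0 _).
have : {ae P, forall w, u (window xi m 1 w) = 0}.
  apply: Rintegral_sqr_eq0 => //.
  rewrite -[RHS]uu0; apply: ae_eq_Rintegral.
  - by apply: measurable_funX; exact: Lfun2_measurable.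
  - by apply: measurable_funM; exact: Lfun2_measurable.
  - by apply: filterS (hn m) => w hw; rewrite expr2 /u hw.
by apply: filterS => w /eqP; rewrite subr_eq0 => /eqP.
Qed.

End block_factors.

(** * Perturbation of second moments and normalized limits *)

Lemma sqrrB_le2 (R : realFieldType) (a b : R) :
  (a - b) ^+ 2 <= 2 * (a ^+ 2 + b ^+ 2).
Proof. by have := sqr_ge0 (a + b); rewrite sqrrB sqrrD !mulr2n; lra. Qed.

(** The difference of the integrands is [2 f g + g ^+ 2], and Young's inequality with weight [s]
    bounds [|2 f g|] by [s^-1 f ^+ 2 + s g ^+ 2]. The weight stays free so that it can grow with [n]
    later. *)
Lemma Rintegral_sqrD_bound d (T : measurableType d) (R : realType)
    (P : probability T R) (f g : T -> R) (s : R) :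
  0 < s -> f \in Lfun P 2%:E -> g \in Lfun P 2%:E ->
  `|\int[P]_x ((f x + g x) ^+ 2) - \int[P]_x (f x ^+ 2)| <=
  s^-1 * \int[P]_x (f x ^+ 2) + (1 + s) * \int[P]_x (g x ^+ 2).
Proof.
move=> s0 f2 g2.
have if2 := Lfun2_integrable_sqr f2.
have ig2 := Lfun2_integrable_sqr g2.
have ifg := Lfun2_integrable_sqr (Lfun2D f2 g2).
have iL (a b : R) : P.-integrable setT (EFin \o (fun x => a * f x ^+ 2 + b * g x ^+ 2)).
  exact: (integrableD measurableT (integrableZl measurableT a if2)
    (integrableZl measurableT b ig2)).
have L (a b : R) : \int[P]_x (a * f x ^+ 2 + b * g x ^+ 2) =
    a * \int[P]_x (f x ^+ 2) + b * \int[P]_x (g x ^+ 2).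
  rewrite RintegralD ?RintegralZl//.
  - exact: (integrableZl measurableT a if2).
  - exact: (integrableZl measurableT b ig2).
have young (a b : R) : `|2 * a * b| <= s^-1 * a ^+ 2 + s * b ^+ 2.
  rewrite -subr_ge0 -(pmulr_rge0 _ s0).
  have -> : s * (s^-1 * a ^+ 2 + s * b ^+ 2 - `|2 * a * b|) =
      (`|a| - s * `|b|) ^+ 2.
    rewrite !normrM (ger0_norm (ler0n _ 2)) mulrBr mulrDr mulrA divff ?gt_eqF//.
    rewrite -[a ^+ 2]real_normK ?num_real// -[b ^+ 2]real_normK ?num_real//.
    by ring.
  exact: sqr_ge0.
have upper : \int[P]_x ((f x + g x) ^+ 2) <=
    \int[P]_x ((1 + s^-1) * f x ^+ 2 + (1 + s) * g x ^+ 2).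
  apply: le_Rintegral => // x _.
  have /ler_normlP[_ yfg] := young (f x) (g x).
  by rewrite sqrrD mulr_natl mulrnAl mulr2n in yfg *; lra.
(* The natural coefficient [1 - s] is weakened to [- s - 1], so that the lower bound mirrors the
   upper one. *)
have lower : \int[P]_x ((1 - s^-1) * f x ^+ 2 + (- s - 1) * g x ^+ 2) <=
    \int[P]_x ((f x + g x) ^+ 2).
  apply: le_Rintegral => // x _.
  have /ler_normlP[yfg _] := young (f x) (g x).
  have := sqr_ge0 (g x).
  by rewrite sqrrD mulr_natl mulrnAl mulr2n in yfg *; lra.
rewrite L in upper; rewrite L in lower.
by rewrite ler_norml; apply/andP; split; lra.
Qed.

Lemma cvg_div_sqrt_bound (R : realType) (V : nat -> R) (v C : R) :
  (forall n, (0 < n)%N -> `|V n - n%:R * v| <= C * Num.sqrt n%:R) ->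
  (fun n => n%:R^-1 * V n) @ \oo --> v.
Proof.
move=> VC.
(* The shift to [n.+1] leaves out [n = 0], where the bound is not assumed. After division by [n.+1]
   the error is at most [C] over the square root of [n.+1]. *)
rewrite -cvg_shiftS /=.
have h : (fun n => C * Num.sqrt (n.+1%:R^-1) : R) @ \oo --> (C * Num.sqrt 0 : R).
  apply: cvgMl_tmp; apply: (cvg_comp (@harmonic R) Num.sqrt cvg_harmonic).
  exact: sqrt_continuous.
rewrite sqrtr0 mulr0 in h.
apply/subr_cvg0/norm_cvg0P.
apply: squeeze_cvgr (cvg_cst 0) h; apply: nearW => n.
rewrite normr_ge0 /=.
have n0 : 0 < n.+1%:R :> R by rewrite ltr0n.
have -> : n.+1%:R^-1 * V n.+1 - v = n.+1%:R^-1 * (V n.+1 - n.+1%:R * v).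
  by field; rewrite gt_eqF.
rewrite normrM gtr0_norm ?invr_gt0// ler_pdivrMl//.
apply: le_trans (VC _ _) _ => //.
rewrite -{1}(mulr1 (Num.sqrt _)) sqrtrV ?ler0n//.
have s0 : 0 < Num.sqrt n.+1%:R :> R by rewrite sqrtr_gt0.
rewrite -[X in _ <= X * _](sqr_sqrtr (ltW n0)).
rewrite le_eqVlt; apply/orP; left; apply/eqP; field.
by rewrite gt_eqF.
Qed.

(** * The martingale-coboundary decomposition *)

Section martingale_coboundary.
Context d (T : measurableType d) (R : realType) (P : probability T R).
Variable xi : int -> {RV P >-> R}.
Hypothesis xi_iid : iid xi.
Variables (m : nat) (f : m.+1.-tuple R -> R).
Hypothesis mf : measurable_fun [set: _] f.
Let X (k : int) (w : T) : R := f (window xi m.+1 k w).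
Hypothesis X_L2 : forall k, X k \in Lfun P 2%:E.
Hypothesis X_mean0 : forall k, \int[P]_w X k w = 0.

(** [p.1] holds the variables conditioned on and [p.2] the next [m], to be integrated out. The block
    starting at [i < m] ends at position [i + m < 2m], so [subtuple] never reads its default
    value. *)
Definition future_sum (p : m.-tuple R * m.-tuple R) : R :=
  \sum_(i < m) f (subtuple m.+1 i (cat_tuple p.1 p.2)).

(* [transfer (xi_k, ..., xi_(k+m-1)) = - E[X_k + ... + X_(k+m-1) | xi_j, j < k + m]];
   the later [X_j] are centered and independent of the conditioning variables. *)
Definition transfer (v : m.-tuple R) : R := - cond_mean xi future_sum v.

Let Y (k : int) (w : T) : R := transfer (window xi m k w).

(* With [X_k = f (window k)] and [Y_k = transfer (window k)] this evaluates to
   [D_k = X_k - Y_(k+1) + Y_k], the increment of [E[sum_j X_j | xi_i, i <= k + m]]. *)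
Definition martingale_part (t : m.+1.-tuple R) : R :=
  f t - transfer (subtuple m 1 t) + transfer (subtuple m 0 t).

Let D (k : int) (w : T) : R := martingale_part (window xi m.+1 k w).

Lemma measurable_future_sum : measurable_fun [set: _] future_sum.
Proof.
apply: measurable_sum => i; apply: measurableT_comp mf _.
apply: measurableT_comp; first exact: measurable_subtuple.
exact: measurable_cat_tuple.
Qed.

Lemma future_sum_window (k : int) (w : T) :
  future_sum (window xi m k w, window xi m (k + m%:Z) w) =
  \sum_(i < m) X (k + i%:Z) w.
Proof.
apply: eq_bigr => i _; rewrite /X /= window_cat -window_sub//.
by rewrite addnS ltn_add2r.
Qed.

Let future_L2 (k : int) : (fun w => \sum_(i < m) X (k + i%:Z) w) \in Lfun P 2%:E.
Proof. by apply: Lfun2_sum => i; exact: X_L2. Qed.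

Let future_window_L2 (k : int) :
  (fun w => future_sum (window xi m k w, window xi m (k + m%:Z) w)) \in Lfun P 2%:E.
Proof. by under eq_fun do rewrite future_sum_window; exact: future_L2. Qed.

Lemma measurable_transfer : measurable_fun [set: _] transfer.
Proof.
apply: measurableT_comp => //.
have iF := Lfun2_integrable (future_window_L2 0).
exact: (measurable_cond_mean xi_iid measurable_future_sum iF).
Qed.

Lemma transfer_Lfun2 k : Y k \in Lfun P 2%:E.
Proof.
have s2 := future_window_L2 k.
have /Lfun2N := cond_mean_Lfun2 xi_iid measurable_future_sum (Lfun2_integrable s2) s2.
exact.
Qed.

Lemma measurable_martingale_part : measurable_fun [set: _] martingale_part.
Proof.
have mt i : measurable_fun [set: m.+1.-tuple R] (transfer \o subtuple m i).
  by apply: measurableT_comp measurable_transfer _; exact: measurable_subtuple.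
by apply: measurable_funD; [apply: measurable_funB => //; exact: (mt 1)|exact: (mt 0)].
Qed.

Lemma martingale_part_window k w : D k w = X k w - Y (k + 1) w + Y k w.
Proof.
by rewrite /D /martingale_part -!window_sub ?addr0 ?add0n ?leqnSn.
Qed.

Lemma martingale_part_Lfun2 k : D k \in Lfun P 2%:E.
Proof.
rewrite (_ : D k = fun w => X k w - Y (k + 1) w + Y k w); last first.
  by apply/funext => w; exact: martingale_part_window.
by apply: Lfun2D; [apply: Lfun2B|]; rewrite ?X_L2 ?transfer_Lfun2.
Qed.

(** * Orthogonality of the martingale part to the past *)

Section past.
Variables (p : nat) (a : int) (z : (p + m).-tuple R -> R).
Hypothesis mz : measurable_fun [set: _] z.
Let Z (w : T) := z (window xi (p + m) a w).
Hypothesis z2 : Z \in Lfun P 2%:E.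

(** Although [transfer] conditions on [m] variables only, it is also the projection onto the longer
    past of [p + m] variables, because the future sum sees only the last [m] of them. *)
Lemma transfer_projection :
  \int[P]_w (Z w * Y (a + p%:Z) w) =
  - \int[P]_w (Z w * \sum_(i < m) X (a + p%:Z + i%:Z) w).
Proof.
(* [F] reads the long window through its last [m] entries, so [cond_mean] of [F] is [cond_mean] of
   [future_sum] at that subtuple. *)
pose F (q : (p + m).-tuple R * m.-tuple R) := future_sum (subtuple m p q.1, q.2).
have mF : measurable_fun [set: _] F.
  apply: measurableT_comp measurable_future_sum _.
  apply: measurable_fun_pair => //.
  by apply: measurableT_comp; [exact: measurable_subtuple|exact: measurable_fst].
have FE w : F (window xi (p + m) a w, window xi m (a + (p + m)%N%:Z) w) =
    \sum_(i < m) X (a + p%:Z + i%:Z) w.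
  by rewrite /F /= -window_sub// PoszD addrA future_sum_window.
have F2 : (fun w => F (window xi (p + m) a w, window xi m (a + (p + m)%N%:Z) w))
    \in Lfun P 2%:E.
  by under eq_fun do rewrite FE; exact: future_L2.
have := cond_meanP xi_iid mF (Lfun2_integrable F2) mz (Lfun2_integrableM z2 F2).
under [X in _ = X -> _]eq_Rintegral do rewrite FE.
move=> <-.
rewrite -mulN1r -RintegralZl//.
  by apply: eq_Rintegral => w _; rewrite /Y (@window_sub _ _ _ _ _ _ (p + m))// /transfer mulrN mulN1r.
apply: Lfun2_integrableM => //.
rewrite (_ : (fun _ => _) = fun w => - Y (a + p%:Z) w).
  exact: Lfun2N (transfer_Lfun2 _).
by apply/funext => w; rewrite /Y (@window_sub _ _ _ _ _ _ (p + m))// /transfer opprK.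
Qed.

End past.

(** With [k = a + p], projecting [Y k] and [Y (k + 1)] turns the integral into a difference of two
    overlapping sums of [X], and only the term with [X (k + m)] survives. *)
Lemma martingale_part_orthogonal (p : nat) (a : int) (z : (p + m).-tuple R -> R) :
  measurable_fun [set: _] z ->
  (fun w => z (window xi (p + m) a w)) \in Lfun P 2%:E ->
  \int[P]_w (z (window xi (p + m) a w) * D (a + p%:Z) w) = 0.
Proof.
move=> mz z2; set Z := fun w => z (window xi (p + m) a w) in z2 *.
(* [Y (k + 1)] is projected onto a past with one more variable, so [z] is read as a function of that
   longer window, ignoring its last entry. *)
have mz' : measurable_fun [set: (p.+1 + m).-tuple R] (z \o subtuple (p + m) 0).
  by apply: measurableT_comp mz _; exact: measurable_subtuple.
have zE w : Z w = (z \o subtuple (p + m) 0) (window xi (p.+1 + m) a w).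
  by rewrite /= -window_sub ?addr0// leqnSn.
have z2' : (fun w => (z \o subtuple (p + m) 0) (window xi (p.+1 + m) a w)) \in Lfun P 2%:E.
  by under eq_fun do rewrite -zE.
have e1 := transfer_projection mz z2.
have := transfer_projection mz' z2'.
under eq_Rintegral do rewrite -zE.
under [X in _ = - X -> _]eq_Rintegral do rewrite -zE.
rewrite -/Z in e1 *.
have -> : a + p.+1%:Z = a + p%:Z + 1 by rewrite -addrA -PoszD addn1.
set k := a + p%:Z in e1 *; move=> e2.
have iM g : g \in Lfun P 2%:E -> P.-integrable setT (EFin \o (fun w => Z w * g w)).
  exact: Lfun2_integrableM.
have iX := iM _ (X_L2 k).
have iY j := iM _ (transfer_Lfun2 j).
have iS j := iM _ (future_L2 j).
transitivity (\int[P]_w (Z w * X k w) - \int[P]_w (Z w * Y (k + 1) w)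
    + \int[P]_w (Z w * Y k w)).
  rewrite -(RintegralB measurableT iX (iY (k + 1))).
  rewrite -(RintegralD measurableT (integrableB measurableT iX (iY (k + 1))) (iY k)).
  by apply: eq_Rintegral => w _; rewrite martingale_part_window mulrDr mulrBr.
rewrite e1 e2 opprK -(RintegralD measurableT iX (iS (k + 1))).
rewrite -(RintegralB measurableT (integrableD measurableT iX (iS (k + 1))) (iS k)).
(* The surviving term: the window of [X (k + m)] starts at [a + (p + m)], just after the window of
   [Z] ends, and [X] is centered. *)
rewrite -[RHS](window_Rintegral_mul0 xi_iid mz mf z2 (X_L2 _) (X_mean0 _)).
apply: eq_Rintegral => w _; rewrite -/(Z w) -/(X _ w) -mulrDr -mulrBr; congr (_ * _).
have -> : X k w + \sum_(i < m) X (k + 1 + i%:Z) w = \sum_(i < m.+1) X (k + i%:Z) w.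
  rewrite big_ord_recl addr0; congr (_ + _); apply: eq_bigr => i _.
  by rewrite -addrA -PoszD.
by rewrite big_ord_recr/= addrAC subrr add0r /k -addrA -PoszD.
Qed.

(** * Second moments of the martingale sum and of the block sum *)

Let A (n : nat) (w : T) : R := \sum_(i < n) D (1 + i%:Z) w.

Lemma martingale_sum_Lfun2 n : A n \in Lfun P 2%:E.
Proof. by apply: Lfun2_sum => i; exact: martingale_part_Lfun2. Qed.

(** Pythagoras for orthogonal increments, by induction on [n]; the increments have equal second
    moments by stationarity. *)
Lemma martingale_sum_sqr n :
  \int[P]_w (A n w ^+ 2) = n%:R * \int[P]_w (D 1 w ^+ 2).
Proof.
elim: n => [|n IH].
  rewrite mul0r -[RHS](probability_Rintegral_cst P 0).
  by apply: eq_Rintegral => w _; rewrite /A big_ord0 expr0n.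
(* This exhibits [A n] as a function of the [n + m] variables from position [1] on, which are in the
   past of [D (1 + n)]. *)
pose z (t : (n + m).-tuple R) := \sum_(i < n) martingale_part (subtuple m.+1 i t).
have mz : measurable_fun [set: _] z.
  apply: measurable_sum => i; apply: measurableT_comp measurable_martingale_part _.
  exact: measurable_subtuple.
have zE w : z (window xi (n + m) 1 w) = A n w.
  apply: eq_bigr => i _; rewrite -window_sub//.
  by rewrite addnS -addSn leq_add2r.
have A2 := martingale_sum_Lfun2 n.
have := martingale_part_orthogonal mz.
move=> /(_ 1); under eq_fun do rewrite zE; move=> /(_ A2).
under eq_Rintegral do rewrite zE.
move=> AD0.
have D2 := martingale_part_Lfun2 (1 + n%:Z).
have iA := Lfun2_integrable_sqr A2.
have iD := Lfun2_integrable_sqr D2.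
have iAD := Lfun2_integrableM A2 D2.
have Dn : \int[P]_w (D (1 + n%:Z) w ^+ 2) = \int[P]_w (D 1 w ^+ 2).
  have mD2 : measurable_fun [set: _] (fun t => martingale_part t ^+ 2).
    exact: measurable_funX measurable_martingale_part.
  exact: (window_Rintegral xi_iid 1 mD2 iD).
transitivity (\int[P]_w (A n w ^+ 2 + 2 * (A n w * D (1 + n%:Z) w) + D (1 + n%:Z) w ^+ 2)).
  by apply: eq_Rintegral => w _; rewrite /A big_ord_recr/= sqrrD mulr_natl.
have i2AD := integrableZl measurableT 2 iAD.
rewrite (RintegralD measurableT (integrableD measurableT iA i2AD) iD).
rewrite (RintegralD measurableT iA i2AD) (RintegralZl 2 measurableT iAD).
rewrite [RHS](_ : _ = n%:R * \int[P]_w (D 1 w ^+ 2) + 2 * 0 +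
  \int[P]_w (D 1 w ^+ 2)); last by rewrite -natr1; ring.
exact: (congr2 +%R (congr2 +%R IH (congr1 ( *%R 2) AD0)) Dn).
Qed.

Lemma block_sum_decomposition n w :
  \sum_(i < n) X (1 + i%:Z) w = A n w + (Y (1 + n%:Z) w - Y 1 w).
Proof.
elim: n => [|n IH]; first by rewrite /A !big_ord0 addr0 subrr addr0.
rewrite /A !big_ord_recr/= IH -/(A n w) martingale_part_window.
have -> : 1 + n.+1%:Z = 1 + n%:Z + 1 :> int by rewrite intS addrC.
by ring.
Qed.

Lemma block_sum_sqr_cvg :
  (fun n => n%:R^-1 * \int[P]_w ((\sum_(i < n) X (1 + i%:Z) w) ^+ 2)) @ \oo -->
  \int[P]_w (D 1 w ^+ 2).
Proof.
set v := \int[P]_w (D 1 w ^+ 2).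
have v0 : 0 <= v by apply: Rintegral_ge0 => w _; exact: sqr_ge0.
pose y := \int[P]_w (Y 1 w ^+ 2).
have y0 : 0 <= y by apply: Rintegral_ge0 => w _; exact: sqr_ge0.
have Yy k : \int[P]_w (Y k w ^+ 2) = y.
  have mt2 : measurable_fun [set: _] (fun t => transfer t ^+ 2).
    exact: measurable_funX measurable_transfer.
  exact: (window_Rintegral xi_iid 1 mt2 (Lfun2_integrable_sqr (transfer_Lfun2 k))).
(* The weight [s = sqrt n] balances the two errors: they become [sqrt n * v] and at most
   [(1 + sqrt n) * (4 * y)], and the latter is at most [8 * y * sqrt n] since [n >= 1]. *)
apply: (@cvg_div_sqrt_bound _ _ v (v + 8 * y)) => n n0.
have s0 : 0 < Num.sqrt n%:R :> R by rewrite sqrtr_gt0 ltr0n.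
have YB2 : (fun w => Y (1 + n%:Z) w - Y 1 w) \in Lfun P 2%:E.
  by apply: Lfun2B; exact: transfer_Lfun2.
have YB : \int[P]_w ((Y (1 + n%:Z) w - Y 1 w) ^+ 2) <= 4 * y.
  have i1 := Lfun2_integrable_sqr (transfer_Lfun2 (1 + n%:Z)).
  have i2 := Lfun2_integrable_sqr (transfer_Lfun2 1).
  have -> : 4 * y = \int[P]_w (2 * (Y (1 + n%:Z) w ^+ 2 + Y 1 w ^+ 2)).
    rewrite (RintegralZl 2 measurableT (integrableD measurableT i1 i2)).
    by rewrite (RintegralD measurableT i1 i2) !Yy; lra.
  apply: le_Rintegral => //; first exact: Lfun2_integrable_sqr YB2.
    exact: (integrableZl measurableT 2 (integrableD measurableT i1 i2)).
  by move=> w _; exact: sqrrB_le2.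
have SE : \int[P]_w ((\sum_(i < n) X (1 + i%:Z) w) ^+ 2) =
    \int[P]_w ((A n w + (Y (1 + n%:Z) w - Y 1 w)) ^+ 2).
  by apply: eq_Rintegral => w _; rewrite block_sum_decomposition.
have := Rintegral_sqrD_bound s0 (martingale_sum_Lfun2 n) YB2.
rewrite -SE martingale_sum_sqr -/v => /le_trans; apply.
have s1 : 1 <= Num.sqrt n%:R :> R by rewrite -[leLHS]sqrtr1 ler_wsqrtr// ler1n.
have -> : (Num.sqrt n%:R)^-1 * (n%:R * v) = Num.sqrt n%:R * v.
  by rewrite -{2}(@sqr_sqrtr _ (n%:R : R)) ?ler0n//; field; rewrite gt_eqF.
have := ler_wpM2l (ltW (addr_gt0 ltr01 s0)) YB.
have := ler_wpM2r y0 s1.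
by lra.
Qed.

End martingale_coboundary.

(** * From zero asymptotic variance to the coboundary *)

Lemma martingale_part_eq0 d (T : measurableType d) (R : realType)
    (P : probability T R) (xi : int -> {RV P >-> R}) (xi_iid : iid xi)
    (m : nat) (f : m.+1.-tuple R -> R) :
  measurable_fun [set: _] f ->
  (forall k, (fun w => f (window xi m.+1 k w)) \in Lfun P 2%:E) ->
  \int[P]_w (martingale_part xi f (window xi m.+1 1 w) ^+ 2) = 0 ->
  forall k, {ae P, forall w, martingale_part xi f (window xi m.+1 k w) = 0}.
Proof.
move=> mf X2 D0 k; apply: Rintegral_sqr_eq0; first exact: martingale_part_Lfun2.
have D2 := Lfun2_integrable_sqr (martingale_part_Lfun2 xi_iid mf X2 k).
have mD2 : measurable_fun [set: _] (fun t => martingale_part xi f t ^+ 2).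
  exact: measurable_funX (measurable_martingale_part xi_iid mf X2).
by rewrite -D0; exact: (window_Rintegral xi_iid 1 mD2 D2).
Qed.

Lemma variance_centered_sum d (T : measurableType d) (R : realType)
    (P : probability T R) (X : nat -> T -> R) (c : R) (n : nat) :
  (forall i, X i \in Lfun P 2%:E) -> (forall i, \int[P]_w X i w = c) ->
  'V_P[(fun w => \sum_(i < n) X i w)%R]%E =
  (\int[P]_w ((\sum_(i < n) (X i w - c)) ^+ 2))%:E.
Proof.
move=> X2 Xc.
have ES j : \int[P]_w (\sum_(i < j) X i w) = j%:R * c.
  elim: j => [|j IH].
    under eq_Rintegral do rewrite big_ord0.
    by rewrite probability_Rintegral_cst mul0r.
  under eq_Rintegral do rewrite big_ord_recr/=.
  rewrite RintegralD ?IH ?Xc//; [|exact: Lfun2_integrable (Lfun2_sum _ _)|exact: Lfun2_integrable].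
  by rewrite -natr1 mulrDl mul1r.
rewrite /variance unlock unlock -/(Rintegral P setT _).
transitivity (\int[P]_w ((\sum_(i < n) (X i w - c)) ^+ 2)%:E)%E.
  apply: eq_integral => w _; congr EFin.
  rewrite !fctE /= ES.
  by rewrite -expr2 sumrB sumr_const card_ord mulr_natl.
rewrite /Rintegral fineK//; apply: integrable_fin_num => //.
apply: (@Lfun2_integrable_sqr _ _ _ P (fun w => \sum_(i < n) (X i w - c))).
by apply: Lfun2_sum => i; apply: Lfun2B => //; exact: Lfun_cst.
Qed.

Unset Implicit Arguments.

Theorem theorem1p6 (R : realType) (d : measure_display) (T : measurableType d)
    (P : probability T R) (l : nat) (l_ge1 : (1 <= l)%N)
    (xi : int -> {RV P >-> R}) (xi_iid : iid xi)
    (f : l.-tuple R -> R) (mf : measurable_fun [set: l.-tuple R] f)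
    (X_L2 : forall k : int, block_factor xi f k \in Lfun P 2%:E)
    (sigma2_0 : asymptotic_variance P (block_factor xi f) = 0%E) :
  exists (g : (l.-1).-tuple R -> R) (mu : R),
    coboundary_decomposition xi (block_factor xi f) g mu /\
    forall (g' : (l.-1).-tuple R -> R) (mu' : R),
      coboundary_decomposition xi (block_factor xi f) g' mu' ->
      exists C : R, {ae P, forall w,
        g' (window xi l.-1 1 w) = g (window xi l.-1 1 w) + C}.
Proof.
case: l l_ge1 f mf X_L2 sigma2_0 => // m _ f mf X_L2 sigma2_0 /=.
pose mu := \int[P]_w f (window xi m.+1 0 w).
have Emu k : \int[P]_w f (window xi m.+1 k w) = mu.
  by apply: window_Rintegral => //; exact: Lfun2_integrable (X_L2 k).
(* The martingale construction needs centered variables, so the mean is removed here and becomes the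
   constant of the decomposition. *)
pose fc t := f t - mu.
have mfc : measurable_fun [set: m.+1.-tuple R] fc.
  by apply: measurable_funB => //; exact: measurable_cst.
have X2 k : (fun w => fc (window xi m.+1 k w)) \in Lfun P 2%:E.
  by apply: Lfun2B; [exact: X_L2|exact: Lfun_cst].
have X0 k : \int[P]_w fc (window xi m.+1 k w) = 0.
  rewrite RintegralB//.
  - by rewrite probability_Rintegral_cst Emu subrr.
  - exact: Lfun2_integrable (X_L2 k).
  - exact: finite_measure_integrable_cst.
have D0 : \int[P]_w (martingale_part xi fc (window xi m.+1 1 w) ^+ 2) = 0.
  have SE n : partial_sum (block_factor xi f) n =
      fun w => \sum_(i < n) f (window xi m.+1 (1 + i%:Z) w).
    apply/funext => w; rewrite /partial_sum big_add1 big_mkord.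
    by apply: eq_bigr => i _; rewrite intS.
  have VE n : 'V_P[partial_sum (block_factor xi f) n]%E =
      (\int[P]_w ((\sum_(i < n) fc (window xi m.+1 (1 + i%:Z) w)) ^+ 2))%:E.
    rewrite SE.
    exact: (variance_centered_sum n (fun i => X_L2 (1 + i%:Z)) (fun i => Emu (1 + i%:Z))).
  move: sigma2_0; rewrite /asymptotic_variance.
  under eq_fun do rewrite VE -EFinM.
  set u := (X in limn X).
  have cu : u @ \oo -->
      (\int[P]_w (martingale_part xi fc (window xi m.+1 1 w) ^+ 2))%:E.
    by apply: cvg_EFin; [exact: nearW|exact: (block_sum_sqr_cvg xi_iid mfc X2 X0)].
  (* As [u] converges, [limn] is its true limit and not a default value, so the hypothesis says that
     the second moment of [D 1] is zero. *)
  by rewrite (cvg_lim _ cu)// => -[].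
exists (transfer xi fc), mu; split; first split.
- exact: measurable_transfer.
- by move=> k; exact: transfer_Lfun2.
- move=> k; apply: filterS (martingale_part_eq0 xi_iid mfc X2 D0 k) => w.
  (* The process in [coboundary_decomposition] is shifted by one: its value at [k - 1] uses the
     window at [k - 1 + 1], which [subrK] turns into the window at [k]. *)
  rewrite martingale_part_window /block_factor subrK => /eqP.
  rewrite /fc -addrA addrC addr_eq0 opprB addrC => /eqP.
  move=> Dw; lra.
have mg := measurable_transfer xi_iid mfc X2.
have Y2 := transfer_Lfun2 xi_iid mfc X2.
have gE := martingale_part_eq0 xi_iid mfc X2 D0.
move=> g' mu' [mg' Y'2 g'E].
pose h t := g' t - transfer xi fc t.
(* Subtracting the two decompositions of [X k] shows that [h] increases by [mu - mu'] from the
   window at [k] to the one at [k + 1]. *)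
have [||k|C hC] := @block_factor_cocycle_constant _ _ _ _ _ xi_iid m h (mu - mu').
- exact: measurable_funB.
- by apply: Lfun2B; [have := Y'2 0; rewrite /block_factor add0r|exact: Y2].
- apply: filterS2 (gE k) (g'E k) => w.
  rewrite martingale_part_window /block_factor subrK /h /fc => Dw g'w.
  by lra.
- by exists C; apply: filterS hC => w <-; rewrite /h addrC subrK.
Qed.
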